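(* Let $E$ be a (directed) graph, let $G(E)$ be the graph inverse semigroup of $E$, and let $L(G(E))$ be the lattice of congruences on $G(E)$. Then $E$ has no forked vertices if and only if $L(G(E))$ is lower-semimodular.
   Context: A (directed) graph $E=(E^0,E^1,\mathbf{s},\mathbf{r})$ consists of a set $E^0$ of vertices, a set $E^1$ of edges (both arbitrary, possibly infinite), and functions $\mathbf{s},\mathbf{r}:E^1\to E^0$ (source and range). A path is a finite sequence $p=e_1\cdots e_n$ of edges with $\mathbf{r}(e_i)=\mathbf{s}(e_{i+1})$ for $1\le i\le n-1$; $\mathbf{s}(p)=\mathbf{s}(e_1)$, $\mathbf{r}(p)=\mathbf{r}(e_n)$; vertices $v$ are paths of length $0$ with $\mathbf{s}(v)=\mathbf{r}(v)=v$. For $u,v\in E^0$ write $u\ge v$ if there is a path (possibly of length $0$) from $u$ to $v$. The graph inverse semigroup $G(E)$ is the semigroup with zero generated by $E^0\cup E^1\cup\{e^{-1}\mid e\in E^1\}$ subject to, for all $u,v\in E^0$ and $e,f\in E^1$: $vu=\delta_{v,u}v$; $\mathbf{s}(e)e=e\mathbf{r}(e)=e$; $\mathbf{r}(e)e^{-1}=e^{-1}\mathbf{s}(e)=e^{-1}$; $e^{-1}f=\delta_{e,f}\mathbf{r}(e)$ (here $\delta$ is the Kronecker delta, so $\delta_{x,y}z$ means $z$ if $x=y$ and the zero element otherwise). A congruence on a semigroup $S$ is an equivalence relation $\rho$ on $S$ such that $(x,y)\in\rho$ implies $(zx,zy),(xz,yz)\in\rho$ for all $z\in S$. $L(S)$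 is the lattice of all congruences on $S$ ordered by containment. A vertex $v\in E^0$ is forked if there exist distinct edges $e,f\in\mathbf{s}^{-1}(v)$ such that (i) $\mathbf{r}(g)\not\ge\mathbf{r}(e)$ for all $g\in\mathbf{s}^{-1}(v)\setminus\{e\}$, and (ii) $\mathbf{r}(g)\not\ge\mathbf{r}(f)$ for all $g\in\mathbf{s}^{-1}(v)\setminus\{f\}$. In a lattice, $a\prec b$ ($b$ covers $a$) means $a<b$ and there is no $c$ with $a<c<b$. A lattice $L$ is lower-semimodular if for all $a,b\in L$, $a\prec a\vee b$ and $b\prec a\vee b$ together imply $a\wedge b\prec a$ and $a\wedge b\prec b$. *)

(* Defs.v *)
From HB Require Import structures.
From mathcomp Require Import all_boot all_order.
From mathcomp Require Import boolp.

Set Implicit Arguments.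
Unset Strict Implicit.
Unset Printing Implicit Defensive.

Import Order.TTheory.

Record graph : Type := Graph {
  vertex : Type;
  edge : Type;
  esource : edge -> vertex;
  erange : edge -> vertex }.

Section Paths.
Variable E : graph.

Fixpoint is_path (u : vertex E) (p : seq (edge E)) (v : vertex E) : Prop :=
  if p is e :: q then esource e = u /\ is_path (erange e) q v else u = v.

Definition reaches (u v : vertex E) : Prop := exists p, is_path u p v.

Definition isolated_exit (v : vertex E) (e : edge E) : Prop :=
  forall g : edge E, esource g = v -> g <> e -> ~ reaches (erange g) (erange e).

Definition forked (v : vertex E) : Prop :=
  exists e f : edge E,
    [/\ esource e = v, esource f = v, e <> f, isolated_exit v e & isolated_exit v f].

End Paths.

(* The graph inverse semigroup: the terms over the generators and 0, modulo the
   least semigroup-with-zero congruence that contains the defining relations. *)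
Inductive term (E : graph) : Type :=
| TZero
| TVertex of vertex E
| TEdge of edge E
| TInv of edge E
| TMul of term E & term E.
Arguments TZero {E}.

HB.instance Definition _ (E : graph) := gen_eqMixin (term E).
HB.instance Definition _ (E : graph) := gen_choiceMixin (term E).

Definition kronecker (E : graph) (A : Type) (x y : A) (t : term E) : term E :=
  if `[< x = y >] then t else TZero.

Inductive term_eq (E : graph) : term E -> term E -> Prop :=
| te_refl t : term_eq t t
| te_sym s t : term_eq s t -> term_eq t s
| te_trans s t r : term_eq s t -> term_eq t r -> term_eq s r
| te_mul s s' t t' :
    term_eq s s' -> term_eq t t' -> term_eq (TMul s t) (TMul s' t')
| te_assoc s t r : term_eq (TMul s (TMul t r)) (TMul (TMul s t) r)
| te_zerol t : term_eq (TMul TZero t) TZero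
| te_zeror t : term_eq (TMul t TZero) TZero
| te_vertex v u :
    term_eq (TMul (TVertex v) (TVertex u)) (kronecker v u (TVertex v))
| te_source_edge e : term_eq (TMul (TVertex (esource e)) (TEdge e)) (TEdge e)
| te_edge_range e : term_eq (TMul (TEdge e) (TVertex (erange e))) (TEdge e)
| te_range_inv e : term_eq (TMul (TVertex (erange e)) (TInv e)) (TInv e)
| te_inv_source e : term_eq (TMul (TInv e) (TVertex (esource e))) (TInv e)
| te_inv_edge e f :
    term_eq (TMul (TInv e) (TEdge f)) (kronecker e f (TVertex (erange e))).

Section GraphInverseSemigroup.
Variable E : graph.

Definition term_eqb : rel (term E) := fun s t => `[< term_eq s t >].

Fact term_eqb_refl : reflexive term_eqb.
Proof. by move=> t; apply/asboolP; exact: te_refl. Qed.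

Fact term_eqb_sym : symmetric term_eqb.
Proof. by move=> s t; apply/asboolP/asboolP; exact: te_sym. Qed.

Fact term_eqb_trans : transitive term_eqb.
Proof. by move=> t s r /asboolP st /asboolP tr; apply/asboolP; apply: te_trans tr. Qed.

Canonical term_eq_equiv :=
  EquivRel term_eqb term_eqb_refl term_eqb_sym term_eqb_trans.

Local Open Scope quotient_scope.

Definition graph_inverse_semigroup : Type := {eq_quot term_eq_equiv}.
Local Notation G := graph_inverse_semigroup.
HB.instance Definition _ := Choice.on G.

Definition gis_class (t : term E) : G := \pi_{eq_quot term_eq_equiv} t.
Definition gis_repr (x : G) : term E := repr (x : {eq_quot term_eq_equiv}).
Definition gis_mul (x y : G) : G := gis_class (TMul (gis_repr x) (gis_repr y)).

Lemma gis_classP s t : gis_class s = gis_class t <-> term_eq s t.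
Proof.
split; first by move/eqP; rewrite eqmodE => /asboolP.
by move=> st; apply/eqP; rewrite eqmodE; apply/asboolP.
Qed.

Lemma gis_reprK x : gis_class (gis_repr x) = x.
Proof. exact: reprK. Qed.

Lemma gis_classM s t : gis_mul (gis_class s) (gis_class t) = gis_class (TMul s t).
Proof. by apply/gis_classP; apply: te_mul; apply/gis_classP; exact: gis_reprK. Qed.

Fact gis_mulA : associative gis_mul.
Proof.
move=> x y z; rewrite -(gis_reprK x) -(gis_reprK y) -(gis_reprK z) !gis_classM.
by apply/gis_classP; exact: te_assoc.
Qed.

HB.instance Definition _ := hasMul.Build G gis_mul.
HB.instance Definition _ := Magma_isSemigroup.Build G gis_mulA.

End GraphInverseSemigroup.

Local Open Scope group_scope.

Record congruence (S : semigroupType) : Type := Congruence {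
  cong_rel :> S -> S -> Prop;
  cong_refl : forall x, cong_rel x x;
  cong_sym : forall x y, cong_rel x y -> cong_rel y x;
  cong_trans : forall x y z, cong_rel x y -> cong_rel y z -> cong_rel x z;
  cong_mull : forall z x y, cong_rel x y -> cong_rel (z * x) (z * y);
  cong_mulr : forall z x y, cong_rel x y -> cong_rel (x * z) (y * z) }.

Section CongruenceLattice.
Variable S : semigroupType.
Implicit Types a b c : congruence S.

HB.instance Definition _ := gen_eqMixin (congruence S).
HB.instance Definition _ := gen_choiceMixin (congruence S).

Definition cong_le : rel (congruence S) :=
  fun a b => `[< forall x y, a x y -> b x y >].

Fact cong_le_refl : reflexive cong_le.
Proof. by move=> a; apply/asboolP. Qed.

Fact cong_le_anti : antisymmetric cong_le.
Proof.
move=> a b /andP[/asboolP ab /asboolP ba].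
have E : cong_rel a = cong_rel b.
  by apply/funext => x; apply/funext => y; apply/propext; split; [exact: ab|exact: ba].
case: a b E {ab ba} => [r r1 r2 r3 r4 r5] [r' s1 s2 s3 s4 s5] /= E.
by case: r' / E in s1 s2 s3 s4 s5 *; congr Congruence; exact: Prop_irrelevance.
Qed.

Fact cong_le_trans : transitive cong_le.
Proof.
move=> b a c /asboolP ab /asboolP bc; apply/asboolP => x y axy.
exact/bc/ab.
Qed.

HB.instance Definition _ :=
  Order.Le_isPOrder.Build (Order.Disp tt tt) (congruence S)
    cong_le_refl cong_le_anti cong_le_trans.

Program Definition cong_meet a b : congruence S :=
  @Congruence S (fun x y => a x y /\ b x y) _ _ _ _ _.
Next Obligation. by split; exact: cong_refl. Qed.
Next Obligation. by split; exact: cong_sym. Qed.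
Next Obligation. by split; apply: cong_trans; eassumption. Qed.
Next Obligation. by split; exact: cong_mull. Qed.
Next Obligation. by split; exact: cong_mulr. Qed.

Program Definition cong_join a b : congruence S :=
  @Congruence S
    (fun x y => forall c, (a <= c)%O -> (b <= c)%O -> c x y) _ _ _ _ _.
Next Obligation. exact: cong_refl. Qed.
Next Obligation. by apply: cong_sym; auto. Qed.
Next Obligation. by apply: (@cong_trans _ _ _ y); auto. Qed.
Next Obligation. by apply: cong_mull; auto. Qed.
Next Obligation. by apply: cong_mulr; auto. Qed.

Fact cong_meetP a b c : (a <= cong_meet b c)%O = (a <= b)%O && (a <= c)%O.
Proof.
apply/idP/andP => [/asboolP h|[/asboolP h1 /asboolP h2]].
  by split; apply/asboolP => x y /h[].
by apply/asboolP => x y axy; split; [exact: h1|exact: h2].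
Qed.

Fact cong_joinP a b c : (cong_join a b <= c)%O = (a <= c)%O && (b <= c)%O.
Proof.
apply/idP/andP => [/asboolP h|[h1 h2]]; last by apply/asboolP => x y; exact.
split; apply/asboolP => x y xy; apply: h => d /asboolP ad /asboolP bd.
  exact: ad.
exact: bd.
Qed.

HB.instance Definition _ :=
  Order.POrder_MeetJoin_isLattice.Build (Order.Disp tt tt) (congruence S)
    cong_meetP cong_joinP.

End CongruenceLattice.

Local Open Scope order_scope.

Definition covered_by d (T : porderType d) (a b : T) : Prop :=
  a < b /\ ~ exists c : T, a < c < b.

Definition lower_semimodular d (L : latticeType d) : Prop :=
  forall a b : L,
    covered_by a (a `|` b) -> covered_by b (a `|` b) ->
    covered_by (a `&` b) a /\ covered_by (a `&` b) b.

(* Main.v *)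
Require Import Defs.
From mathcomp Require Import all_boot all_order.
From mathcomp Require Import boolp.
From Stdlib Require Import Setoid Morphisms.

(** Every nonzero element of the graph inverse semigroup is [p q^-1] for two
    paths [p] and [q] with the same end [v], and every congruence contains
    [p q^-1] in its zero class exactly when it contains [v] there.  A congruence
    [a] thus has a zero class [Z_a], an ideal given by a hereditary set of
    vertices.  Outside of [Z_a], two related elements [p q^-1] and [p' q'^-1]
    must have [p] and [p'] comparable, and likewise [q] and [q'], since
    [p^-1 p'] vanishes otherwise.  So the relation there is controlled by its
    trace (which paths [p] from [v] satisfy [v ~ p p^-1]) and by the closed
    paths [m] at [v] with [v ~ m]; this is [related_of_trace_closed].

    Forks obstruct lower semimodularity.  Let [v] be forked by [e] and [f], let
    [t] collapse all that [v] reaches, and let [a] be the largest congruence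
    under [t] for which the ideal of the vertices that [v] reaches and that do
    not reach [r(e)] is a union of classes; let [b] be the same for [f].  Anything
    strictly between [a] and [t], or equal to [t], collapses [r(e)], and since [v] is related to [e e^-1] in [a], it
    collapses [v] too; so [t] covers [a], and likewise [b].  But joining
    [a] /\ [b] with the ideal of [a] gives a congruence strictly between
    [a] /\ [b] and [a]: it kills [r(f)], which [b] does not, and it does not
    relate [v] to [e e^-1], because that would make [b] kill [r(f)].

    Conversely let [c] be the join of [a] and [b] and cover both.  If [Z_b] is
    smaller than [Z_c], then collapsing [Z_c] leads from [b] to [c], so [b] and
    [c] agree outside of [Z_c].  Comparing zero classes then gives in most cases
    that [a] is contained in [b] up to collapsing [Z_a], or the same with the
    roles exchanged, and [meet_covered_criterion] turns this into the two
    covering relations for the meet.  Three cases take more.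

    - All three zero classes coincide.  Then [a <= d] whenever
      [a /\ b <= d <= a <= d \/ b] ([modular_below]).  For the trace this is a
      matter of single edges.  For closed paths, the chain of [d]- and [b]-steps
      from [v] to a closed path [s] can be moved into the closed paths at [v]
      that the join relates to [v], which form a commutative cancellative monoid.

    - [Z_b] is smaller than [Z_a], which is smaller than [Z_c].  Then [b] relates
      everything in [Z_c] to [Z_a], so each vertex of [Z_c] outside of [Z_a] has
      only one way to go, up to edges killed by [b], until it enters [Z_a], and [a] relates nothing there that
      [b] does not relate ([nested_zero_class]).

    - [Z_a] and [Z_b] are incomparable.  A vertex in [Z_c] outside of both is the
      source of a path into [Z_b] that survives in [a] and of one into [Z_a] that
      survives in [b]; the vertex where these two paths diverge is forked
      ([forked_of_diverging]).  Without forks, [Z_c] is the union of [Z_a] and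
      [Z_b], which suffices for the criterion. *)

Set Implicit Arguments.
Unset Strict Implicit.
Unset Printing Implicit Defensive.

Import Order.TTheory.
Local Open Scope group_scope.

#[local] Hint Resolve cong_refl : core.

(** * Congruences of a semigroup with zero *)

Section CongruenceTheory.
Variable S : semigroupType.
Implicit Types (a b c d : congruence S) (I : S -> Prop) (x y : S).

#[export] Instance cong_rel_Equivalence c : Equivalence (cong_rel c).
Proof.
split; [exact: cong_refl | exact: cong_sym | exact: cong_trans].
Qed.

#[export] Instance cong_rel_mul_Proper c :
  Proper (cong_rel c ==> cong_rel c ==> cong_rel c) (@mul S).
Proof.
move=> x x' xx' y y' yy'; apply: (@cong_trans _ c _ (x' * y)).
  exact: cong_mulr.
exact: cong_mull.
Qed.

Lemma cong_leP a b : reflect (forall x y, a x y -> b x y) (a <= b)%O.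
Proof. exact: asboolP. Qed.

Lemma covered_byP a c : covered_by a c <->
  (a < c)%O /\ forall d, (a <= d)%O -> (d <= c)%O -> (d <= a)%O \/ (c <= d)%O.
Proof.
split=> -[ac H]; split=> //.
  move=> d ad dc; apply: contrapT => /not_orP[/negP nda /negP ncd].
  by apply: H; exists d; rewrite !lt_leAnge ad nda dc ncd.
case=> d; rewrite !lt_leAnge => /andP[/andP[ad /negP nda] /andP[dc /negP ncd]].
by case: (H d ad dc).
Qed.

(** The join is the transitive closure of the union; the closure is encoded as
    the set of points that lie in every predicate closed under both relations. *)
Program Definition cong_chain a b : congruence S :=
  @Congruence S (fun x y => forall P : S -> Prop, P x ->
    (forall u v, P u -> a u v \/ b u v -> P v) -> P y) _ _ _ _ _.
Next Obligation.
move: P H0 H1; apply: (H (fun t => forall P : S -> Prop, P t ->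
  (forall u v, P u -> a u v \/ b u v -> P v) -> P x)) => // u v IH uv P Pv step.
apply: (IH P) => //; apply: (step v) => //.
by case: uv => uv; [left | right]; exact: cong_sym.
Qed.
Next Obligation. by apply: H0 => //; apply: H. Qed.
Next Obligation.
apply: (H (fun t => P (z * t))) => // u v Pu uv; apply: H1 Pu _.
by case: uv => uv; [left | right]; exact: cong_mull.
Qed.
Next Obligation.
apply: (H (fun t => P (t * z))) => // u v Pu uv; apply: H1 Pu _.
by case: uv => uv; [left | right]; exact: cong_mulr.
Qed.

Lemma cong_join_ind a b x (P : S -> Prop) : P x ->
    (forall u v, (a `|` b)%O x u -> P u -> a u v \/ b u v -> P v) ->
  forall y, (a `|` b)%O x y -> P y.
Proof.
move=> Px step y xy.
have /cong_leP le_chain : (a `|` b <= cong_chain a b)%O.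
  rewrite leUx; apply/andP; split; apply/cong_leP => u v uv Q Qu stepQ.
    by apply: stepQ Qu _; left.
  by apply: stepQ Qu _; right.
suff [] : (a `|` b)%O x y /\ P y by [].
apply: (le_chain _ _ xy (fun t => (a `|` b)%O x t /\ P t)).
  by split=> //; exact: cong_refl.
move=> u v [xu Pu] uv; split; last exact: step uv.
apply: cong_trans xu _.
have /cong_leP lea : (a <= a `|` b)%O by exact: leUl.
have /cong_leP leb : (b <= a `|` b)%O by exact: leUr.
by case: uv => [/lea|/leb].
Qed.

Definition ideal I := forall x y, I x \/ I y -> I (x * y).

Definition saturation a I x := exists2 k, I k & a x k.

(** This is the join of [a] with the congruence collapsing the ideal [I] to a
    point: as [I] is an ideal, so is its saturation, and no longer chains
    occur. *)
Program Definition rees_join a I (idealI : ideal I) : congruence S :=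
  @Congruence S (fun x y => a x y \/ (saturation a I x /\ saturation a I y))
    _ _ _ _ _.
Next Obligation. by case: H => [/cong_sym|[]]; [left | right]. Qed.
Next Obligation.
case: H H0 => [xy|[sx [k Ik yk]]] [yz|[sy sz]].
- by left; apply: cong_trans yz.
- right; split=> //; case: sy => k Ik yk; exists k => //; exact: cong_trans yk.
- by right; split=> //; exists k => //; apply: cong_trans yk; exact: cong_sym.
- by right.
Qed.
Next Obligation.
case: H => [xy|[[k Ik xk] [l Il yl]]]; first by left; exact: cong_mull.
by right; split; [exists (z * k) | exists (z * l)];
  try (by apply: idealI; right); exact: cong_mull.
Qed.
Next Obligation.
case: H => [xy|[[k Ik xk] [l Il yl]]]; first by left; exact: cong_mulr.
by right; split; [exists (k * z) | exists (l * z)];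
  try (by apply: idealI; left); exact: cong_mulr.
Qed.

Lemma le_rees_join a I (idealI : ideal I) : (a <= rees_join a idealI)%O.
Proof. by apply/cong_leP => x y; left. Qed.

Lemma rees_join_ideal a I (idealI : ideal I) x y :
  I x -> I y -> rees_join a idealI x y.
Proof. by move=> Ix Iy; right; split; [exists x | exists y] => //; exact: cong_refl. Qed.

Lemma rees_join_le a c I (idealI : ideal I) :
  (a <= c)%O -> (forall x y, I x -> I y -> c x y) -> (rees_join a idealI <= c)%O.
Proof.
move=> /cong_leP ac cI; apply/cong_leP => x y [/ac//|[[k Ik /ac xk] [l Il /ac yl]]].
by rewrite xk yl; exact: cI.
Qed.

Section Zero.
Variable z : S.
Hypotheses (mul0x : forall x, z * x = z) (mulx0 : forall x, x * z = z).

Definition zero_class c : S -> Prop := fun x => c x z.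

Lemma zero_class_ideal c : ideal (zero_class c).
Proof.
move=> x y; rewrite /zero_class => -[->|->]; first by rewrite mul0x.
by rewrite mulx0.
Qed.

Lemma zero_class_cong c x y : c x y -> zero_class c x <-> zero_class c y.
Proof. by rewrite /zero_class => ->. Qed.

Lemma zero_class_zero c : zero_class c z.
Proof. exact: cong_refl. Qed.

Lemma zero_classes_related c x y : zero_class c x -> zero_class c y -> c x y.
Proof. by rewrite /zero_class => -> ->. Qed.

(** Chains of steps in [a] and [b] that start in a common zero class never
    leave it. *)
Lemma zero_class_join a b : (forall x, zero_class a x <-> zero_class b x) ->
  forall x, zero_class (a `|` b)%O x -> zero_class a x.
Proof.
move=> ab x /cong_sym; apply: cong_join_ind; first exact: zero_class_zero.
move=> u v _ au [/zero_class_cong <- //|uv].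
by apply/ab; apply/(zero_class_cong uv)/ab.
Qed.

(** Collapsing an ideal that [a] does not collapse already jumps all the way up
    to a cover, so everything that the cover kills is [a]-related to the
    ideal. *)
Lemma covered_by_saturation a c I : covered_by a c -> ideal I -> I z ->
    (forall x, I x -> zero_class c x) -> ~ (forall x, I x -> zero_class a x) ->
  forall x y, c x y -> a x y \/ (saturation a I x /\ saturation a I y).
Proof.
move=> /covered_byP[/ltW ac cov] idealI Iz Ic nIa.
have [||le_a|/cong_leP//] := cov (rees_join a idealI).
- exact: le_rees_join.
- by apply: rees_join_le => // x y /Ic ? /Ic ?; exact: zero_classes_related.
- case: nIa => x Ix; have /cong_leP := le_a; apply.
  exact: rees_join_ideal.
Qed.

(** The zero class of the cover is its own saturation, so collapsing it adds no
    further pairs. *)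
Lemma covered_by_zero_class a c : covered_by a c ->
    ~ (forall x, zero_class c x -> zero_class a x) ->
  forall x y, c x y -> a x y \/ (zero_class c x /\ zero_class c y).
Proof.
move=> cov nca x y cxy.
have ac : (a <= c)%O by case: cov => /ltW.
case: (covered_by_saturation cov (@zero_class_ideal c) (zero_class_zero c) _ nca cxy) => //.
  by left.
move=> [[k ck xk] [l cl yl]]; right; split.
- by apply/(zero_class_cong (y := k)) => //; have /cong_leP := ac; apply.
- by apply/(zero_class_cong (y := l)) => //; have /cong_leP := ac; apply.
Qed.

(** Extends [d], seen as a congruence of the ideal [I], along [b]: each point is
    first moved into [I] by [b]. *)
Program Definition transport_join b d I (idealI : ideal I)
    (bd : forall x y, I x -> I y -> b x y -> d x y) : congruence S :=
  @Congruence S (fun x y => b x y \/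
    exists x' y', [/\ I x', I y', b x x', b y y' & d x' y']) _ _ _ _ _.
Next Obligation.
case: H => [/cong_sym|[x' [y' [? ? ? ? /cong_sym ?]]]]; first by left.
by right; exists y', x'.
Qed.
Next Obligation.
case: H H0 => [xy|[x' [y' [Ix Iy bx by_ dxy]]]] [yz|[x2 [z' [Ix2 Iz bx2 bz dxz]]]].
- by left; apply: cong_trans yz.
- by right; exists x2, z'; split=> //; apply: cong_trans bx2.
- right; exists x', y'; split=> //; apply: cong_trans by_; exact: cong_sym.
- right; exists x', z'; split=> //; apply: cong_trans dxy _.
  by apply: cong_trans dxz; apply: bd => //; rewrite -by_ -bx2.
Qed.
Next Obligation.
case: H => [xy|[x' [y' [Ix Iy bx by_ dxy]]]]; first by left; exact: cong_mull.
right; exists (z0 * x'), (z0 * y'); split; try exact: cong_mull;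
  by apply: idealI; right.
Qed.
Next Obligation.
case: H => [xy|[x' [y' [Ix Iy bx by_ dxy]]]]; first by left; exact: cong_mulr.
right; exists (x' * z0), (y' * z0); split; try exact: cong_mulr;
  by apply: idealI; left.
Qed.

(** A congruence between the meet and [b] is tested by collapsing [Z_a] on top of
    it, which lands between [a] and the join; one between the meet and [a] is
    tested by transporting it along [b], which lands between [b] and the
    join. *)
Lemma meet_covered_criterion a b :
    covered_by a (a `|` b)%O -> covered_by b (a `|` b)%O ->
    (forall x y, a x y -> b x y \/ (zero_class a x /\ zero_class a y)) ->
  covered_by (a `&` b)%O a /\ covered_by (a `&` b)%O b.
Proof.
move=> /covered_byP[ac cova] /covered_byP[bc covb] ab_or.
have nab : ~~ (a <= b)%O by apply/negP => /join_r E; rewrite E ltxx in bc.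
have nba : ~~ (b <= a)%O by apply/negP => /join_l E; rewrite E ltxx in ac.
have [/cong_leP lea /cong_leP leb] := (ltW ac, ltW bc).
split; apply/covered_byP; split.
- by rewrite lt_leAnge leIl lexI lexx.
- move=> d /cong_leP id /cong_leP da.
  have bd x y : zero_class a x -> zero_class a y -> b x y -> d x y.
    by move=> ? ? bxy; apply: id; split=> //; exact: zero_classes_related.
  case: (covb (transport_join (@zero_class_ideal a) bd)).
  + by apply/cong_leP => x y; left.
  + apply/cong_leP => x y [/leb//|[x' [y' [_ _ /leb bx /leb by_ /da/lea dxy]]]].
    by rewrite bx dxy by_.
  + move=> /cong_leP le_b; left; apply/cong_leP => x y dxy; split; first exact: da.
    case: (ab_or _ _ (da _ _ dxy)) => // -[ax ay].
    by apply: le_b; right; exists x, y.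
  + move=> /cong_leP ge_c; right; apply/cong_leP => x y axy.
    case: (ab_or _ _ axy) => [bxy|[ax ay]]; first by apply: id.
    have [bxy|[x' [y' [ax' ay' bx by_ dxy]]]] := ge_c _ _ (lea _ _ axy).
      by apply: (bd _ _ ax ay).
    apply: (cong_trans (bd _ _ ax ax' bx)); apply: cong_trans dxy _.
    by apply: cong_sym; apply: (bd _ _ ay ay').
- by rewrite lt_leAnge leIr lexI lexx andbT.
- move=> d /cong_leP id /cong_leP db.
  case: (cova (rees_join d (@zero_class_ideal a))).
  + apply/cong_leP => x y axy.
    case: (ab_or _ _ axy) => [bxy|[ax ay]]; first by left; apply: id.
    exact: rees_join_ideal.
  + apply: rees_join_le; first by apply/cong_leP => x y /db/leb.
    by move=> x y ax ay; apply: lea; exact: zero_classes_related.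
  + move=> /cong_leP le_a; left; apply/cong_leP => x y dxy; split; last exact: db.
    by apply: le_a; left.
  + move=> /cong_leP ge_c; right; apply/cong_leP => x y bxy.
    case: (ge_c _ _ (leb _ _ bxy)) => // -[[x' ax' dx] [y' ay' dy]].
    rewrite dx dy; apply: id; split; first exact: zero_classes_related.
    by rewrite -(db _ _ dx) -(db _ _ dy).
Qed.

End Zero.
End CongruenceTheory.

(** * Paths and normal forms *)

Section Paths.
Variable E : graph.
Implicit Types (u v w : vertex E) (p q r : seq (edge E)).

Lemma is_path_cat u p q w :
  is_path u (p ++ q) w <-> exists2 v, is_path u p v & is_path v q w.
Proof.
elim: p u => [|e p IH] u /=.
  by split=> [|[v -> //]]; exists u.
split=> [[<-] /IH[v]|[v [<- pv] qw]]; first by exists v.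
by split=> //; apply/IH; exists v.
Qed.

Lemma is_path_target u p v w : is_path u p v -> is_path u p w -> v = w.
Proof.
elim: p u => [|e p IH] u /=; first by move=> <-.
by move=> [_ ?] [_]; exact: IH.
Qed.

Lemma is_path_prefix u p q v w :
  is_path u p v -> is_path u (p ++ q) w -> is_path v q w.
Proof. by move=> pv /is_path_cat[v' /(is_path_target pv) <-]. Qed.

(** The last case is the only one in which [p^-1 q] vanishes. *)
Lemma path_compare p q : [\/ exists r, q = p ++ r, exists r, p = q ++ r |
  exists l e f p' q', [/\ p = l ++ e :: p', q = l ++ f :: q' & e <> f]].
Proof.
elim: p q => [|e p IH] [|f q]; try by [constructor 1; eexists | constructor 2; eexists].
have [<-|nef] := pselect (e = f); last first.
  by constructor 3; exists [::], e, f, p, q.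
have [[r ->]|[r ->]|[l [e' [f' [p' [q' [-> -> ?]]]]]]] := IH q.
- by constructor 1; exists r.
- by constructor 2; exists r.
- by constructor 3; exists (e :: l), e', f', p', q'.
Qed.

End Paths.

Section NormalForms.
Variable E : graph.
Local Notation G := (graph_inverse_semigroup E).
Implicit Types (u v w : vertex E) (p q r : seq (edge E)) (x y : G).

Definition gzero : G := gis_class TZero.
Definition gvertex v : G := gis_class (TVertex v).
Definition gedge e : G := gis_class (@TEdge E e).
Definition ginv e : G := gis_class (@TInv E e).

Lemma gmulE (s t : term E) : gis_class s * gis_class t = gis_class (TMul s t) :> G.
Proof. exact: gis_classM. Qed.

Lemma gmul0x x : gzero * x = gzero.
Proof. by rewrite -(gis_reprK x) gmulE; apply/gis_classP; exact: te_zerol. Qed.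
Lemma gmulx0 x : x * gzero = gzero.
Proof. by rewrite -(gis_reprK x) gmulE; apply/gis_classP; exact: te_zeror. Qed.

Lemma gvertexK v : gvertex v * gvertex v = gvertex v.
Proof.
rewrite gmulE; apply/gis_classP; move: (te_vertex v v); rewrite /kronecker.
by rewrite asboolT.
Qed.
Lemma gvertex_neq v u : v <> u -> gvertex v * gvertex u = gzero.
Proof.
move=> vu; rewrite gmulE; apply/gis_classP; move: (te_vertex v u).
by rewrite /kronecker asboolF.
Qed.
Lemma gsource_edge e : gvertex (esource e) * gedge e = gedge e.
Proof. by rewrite gmulE; apply/gis_classP; exact: te_source_edge. Qed.
Lemma gedge_range e : gedge e * gvertex (erange e) = gedge e.
Proof. by rewrite gmulE; apply/gis_classP; exact: te_edge_range. Qed.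
Lemma grange_inv e : gvertex (erange e) * ginv e = ginv e.
Proof. by rewrite gmulE; apply/gis_classP; exact: te_range_inv. Qed.
Lemma ginv_source e : ginv e * gvertex (esource e) = ginv e.
Proof. by rewrite gmulE; apply/gis_classP; exact: te_inv_source. Qed.
Lemma ginv_edge e : ginv e * gedge e = gvertex (erange e).
Proof.
rewrite gmulE; apply/gis_classP; move: (te_inv_edge e e); rewrite /kronecker.
by rewrite asboolT.
Qed.
Lemma ginv_edge_neq e f : e <> f -> ginv e * gedge f = gzero.
Proof.
move=> ef; rewrite gmulE; apply/gis_classP; move: (te_inv_edge e f).
by rewrite /kronecker asboolF.
Qed.

(** The path [p] from [u], and its inverse; the vertex [u] only matters for the
    empty path. *)
Fixpoint gpath u p : G :=
  if p is e :: q then gedge e * gpath (erange e) q else gvertex u.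
Fixpoint gpathV u p : G :=
  if p is e :: q then gpathV (erange e) q * ginv e else gvertex u.

Lemma gpath_source u p v : is_path u p v -> gvertex u * gpath u p = gpath u p.
Proof.
case: p => [|e p] /=; first by rewrite gvertexK.
by move=> [<- _]; rewrite mulgA gsource_edge.
Qed.

Lemma gpathV_source u p v : is_path u p v -> gpathV u p * gvertex u = gpathV u p.
Proof.
case: p => [|e p] /=; first by rewrite gvertexK.
by move=> [<- _]; rewrite -mulgA ginv_source.
Qed.

Lemma gpath_target u p v : is_path u p v -> gpath u p * gvertex v = gpath u p.
Proof.
elim: p u => [|e p IH] u /=; first by move=> ->; rewrite gvertexK.
by move=> [_ pv]; rewrite -mulgA IH.
Qed.

Lemma gpathV_target u p v : is_path u p v -> gvertex v * gpathV u p = gpathV u p.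
Proof.
elim: p u => [|e p IH] u /=; first by move=> ->; rewrite gvertexK.
by move=> [_ pv]; rewrite mulgA IH.
Qed.

Lemma gpath_cat u p v q w : is_path u p v -> is_path v q w ->
  gpath u (p ++ q) = gpath u p * gpath v q.
Proof.
elim: p u => [|e p IH] u /=; first by move=> -> qw; rewrite (gpath_source qw).
by move=> [_ pv] qw; rewrite -mulgA -IH.
Qed.

Lemma gpathV_cat u p v q w : is_path u p v -> is_path v q w ->
  gpathV u (p ++ q) = gpathV v q * gpathV u p.
Proof.
elim: p u => [|e p IH] u /=; first by move=> -> qw; rewrite (gpathV_source qw).
by move=> [_ pv] qw; rewrite mulgA -IH.
Qed.

Lemma gpathVK u p v : is_path u p v -> gpathV u p * gpath u p = gvertex v.
Proof.
elim: p u => [|e p IH] u /=; first by move=> ->; rewrite gvertexK.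
move=> [_ pv]; rewrite mulgA -(mulgA _ (ginv e)) ginv_edge (gpathV_source pv).
exact: IH.
Qed.

Lemma gpathKV u p v : is_path u p v -> gpath u p * gpathV u p * gpath u p = gpath u p.
Proof. by move=> pv; rewrite -mulgA (gpathVK pv) (gpath_target pv). Qed.

Lemma gpathVKV u p v : is_path u p v -> gpathV u p * (gpath u p * gpathV u p) = gpathV u p.
Proof. by move=> pv; rewrite mulgA (gpathVK pv) (gpathV_target pv). Qed.

Lemma gpathV_path_cat u p v q w : is_path u p v -> is_path v q w ->
  gpathV u p * gpath u (p ++ q) = gpath v q.
Proof.
move=> pv qw; rewrite (gpath_cat pv qw) mulgA (gpathVK pv).
exact: gpath_source qw.
Qed.

Lemma gpathV_cat_path u p v q w : is_path u p v -> is_path v q w ->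
  gpathV u (p ++ q) * gpath u p = gpathV v q.
Proof.
move=> pv qw; rewrite (gpathV_cat pv qw) -mulgA (gpathVK pv).
exact: gpathV_source qw.
Qed.

Lemma gpathV_path_fork u l e f p q v w : e <> f ->
    is_path u (l ++ e :: p) v -> is_path u (l ++ f :: q) w ->
  gpathV u (l ++ e :: p) * gpath u (l ++ f :: q) = gzero.
Proof.
move=> nef /is_path_cat[m lm /= ep] /is_path_cat[m' /(is_path_target lm) <- /= fq].
rewrite (gpathV_cat lm (q := e :: p) ep) (gpath_cat lm (q := f :: q) fq).
rewrite mulgA -(mulgA _ (gpathV u l)) (gpathVK lm) (gpathV_source (p := e :: p) ep) /=.
by rewrite mulgA -(mulgA _ (ginv e)) ginv_edge_neq // gmulx0 gmul0x.
Qed.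

Lemma gpathV_path_neq u u' p q v w : u <> u' -> is_path u p v -> is_path u' q w ->
  gpathV u p * gpath u' q = gzero.
Proof.
move=> uu' pv qw; rewrite -(gpathV_source pv) -(gpath_source qw).
by rewrite mulgA -(mulgA _ (gvertex u)) gvertex_neq // gmulx0 gmul0x.
Qed.

Lemma gpathV_path_cases u u' p q v w : is_path u p v -> is_path u' q w ->
  gpathV u p * gpath u' q = gzero \/
  (u = u' /\ ((exists2 r, q = p ++ r & is_path v r w) \/
              (exists2 r, p = q ++ r & is_path w r v))).
Proof.
move=> pv qw; have [uu'|uu'] := pselect (u = u'); last first.
  by left; exact: gpathV_path_neq uu' pv qw.
rewrite -{}uu' in qw *.
have [[r E1]|[r E1]|[l [e [f [p' [q' [E1 E2 nef]]]]]]] := path_compare p q.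
- by right; split=> //; left; exists r => //; rewrite E1 in qw; exact: is_path_prefix pv qw.
- by right; split=> //; right; exists r => //; rewrite E1 in pv; exact: is_path_prefix qw pv.
- by left; subst p q; exact: gpathV_path_fork pv qw.
Qed.

Variant normal_form_spec : G -> Prop :=
| NormalZero : normal_form_spec gzero
| NormalPath u p v q u' of is_path u p v & is_path u' q v :
    normal_form_spec (gpath u p * gpathV u' q).

Lemma normal_form x : normal_form_spec x.
Proof.
rewrite -(gis_reprK x); elim: (gis_repr x) => [|v|e|e|s IHs t IHt].
- exact: NormalZero.
- rewrite -/(gvertex v) -gvertexK.
  by apply: (@NormalPath v [::] v [::] v).
- have -> : gis_class (TEdge e) = gpath (esource e) [:: e] * gpathV (erange e) [::].
    by rewrite /= -!mulgA gvertexK gedge_range.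
  by apply: (@NormalPath _ _ (erange e)).
- have -> : gis_class (TInv e) = gpath (erange e) [::] * gpathV (esource e) [:: e].
    by rewrite /= mulgA gvertexK grange_inv.
  by apply: (@NormalPath _ _ (erange e)).
- rewrite -gmulE; case: IHs => [|u p v q u' pv qv]; first by rewrite gmul0x; exact: NormalZero.
  case: IHt => [|w p' v' q' w' pv' qv']; first by rewrite gmulx0; exact: NormalZero.
  rewrite mulgA -(mulgA _ (gpathV u' q)).
  have [->|[E1 [[r E2 rv]|[r E2 rv]]]] := gpathV_path_cases qv pv'.
  + by rewrite gmulx0 gmul0x; exact: NormalZero.
  + subst p' w; rewrite (gpathV_path_cat qv rv) -(gpath_cat pv rv).
    by apply: NormalPath qv'; apply/is_path_cat; exists v.
  + subst q w; rewrite (gpathV_cat_path pv' rv) -mulgA -(gpathV_cat qv' rv).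
    by apply: NormalPath pv _; apply/is_path_cat; exists v'.
Qed.

End NormalForms.

Local Notation "0" := (gzero _).
Local Notation "''1_' v" := (gvertex v)
  (at level 8, v at level 2, format "''1_' v").

(** * Paths modulo a congruence *)

Section PathsModulo.
Variable E : graph.
Local Notation G := (graph_inverse_semigroup E).
Implicit Types (u v w : vertex E) (p q r : seq (edge E)) (x y : G).
Implicit Types (a b c d e : congruence G).

Definition gproj u p : G := gpath u p * gpathV u p.

Lemma gproj_source u p v : is_path u p v -> gproj u p * '1_u = gproj u p.
Proof. by move=> pv; rewrite /gproj -mulgA (gpathV_source pv). Qed.

Lemma gproj_path u p v : is_path u p v -> gproj u p * gpath u p = gpath u p.
Proof. exact: gpathKV. Qed.

Lemma gproj_cat u p v q w : is_path u p v -> is_path v q w ->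
  gproj u (p ++ q) = gpath u p * gproj v q * gpathV u p.
Proof. by move=> pv qw; rewrite /gproj (gpath_cat pv qw) (gpathV_cat pv qw) !mulgA. Qed.

Lemma gpath_conj u p v : is_path u p v -> gpathV u p * '1_u * gpath u p = '1_v.
Proof. by move=> pv; rewrite (gpathV_source pv) (gpathVK pv). Qed.

Lemma gproj_conj u p v q w : is_path u p v -> is_path v q w ->
  gpathV u p * gproj u (p ++ q) * gpath u p = gproj v q.
Proof.
move=> pv qw; rewrite (gproj_cat pv qw) !mulgA (gpathVK pv).
rewrite -!mulgA (gpathVK pv) (gpathV_source qw).
by rewrite mulgA (gpath_source qw).
Qed.

Variable c : congruence G.

Lemma gvertex_zero_of u p v q u' : is_path u p v -> is_path u' q v ->
  c (gpath u p * gpathV u' q) 0 -> c '1_v 0.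
Proof.
move=> pv qv h.
have -> : '1_v = gpathV u p * (gpath u p * gpathV u' q) * gpath u' q.
  by rewrite mulgA (gpathVK pv) -mulgA (gpathVK qv) gvertexK.
by rewrite h gmulx0 gmul0x.
Qed.

Lemma normal_form_zero u p v q u' : is_path u p v -> is_path u' q v ->
  c '1_v 0 -> c (gpath u p * gpathV u' q) 0.
Proof. by move=> pv qv h; rewrite -(gpath_target pv) h gmulx0 gmul0x. Qed.

Lemma gvertex_zero_path u p v : is_path u p v -> c '1_u 0 -> c '1_v 0.
Proof. by move=> pv h; rewrite -(gpath_conj pv) h gmulx0 gmul0x. Qed.

Lemma gvertex_zero_gproj u p v : is_path u p v -> c '1_u (gproj u p) ->
  c '1_v 0 -> c '1_u 0.
Proof. by move=> pv -> vz; exact: normal_form_zero vz. Qed.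

(** As [v x v ~ v] does not vanish, [x] is some [p q^-1] with [p] and [q] from [v].
    Multiplication by [p p^-1] on the left fixes [x], hence fixes [v] modulo [c];
    the same holds for [q q^-1] on the right. *)
Lemma related_to_vertex v x : c '1_v x -> ~ c '1_v 0 ->
  exists p q w, [/\ is_path v p w, is_path v q w, x = gpath v p * gpathV v q,
     c '1_v (gproj v p) & c '1_v (gproj v q)].
Proof.
move=> vx nv0; case: (normal_form x) vx => [//|u p w q u' pw qw] vx.
have [E1|uv] := pselect (v = u); last first.
  case: nv0; rewrite -gvertexK {2}vx -(gpath_source pw) !mulgA.
  by rewrite gvertex_neq // !gmul0x.
have [E2|uv'] := pselect (v = u'); last first.
  case: nv0; rewrite -gvertexK {1}vx -(gpathV_source qw) -!mulgA.
  by rewrite gvertex_neq ?gmulx0 //; exact: nesym.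
subst u u'; exists p, q, w; split=> //.
- rewrite -(gproj_source pw) {2}vx /gproj !mulgA (gpathKV pw); exact: vx.
- have E1 : '1_v * gproj v q = gproj v q by rewrite /gproj mulgA (gpath_source qw).
  by rewrite -E1 {2}vx /gproj -!mulgA (gpathVKV qw).
Qed.

(** If [v ~ p p^-1], then a path from [v] that branches off [p] is annihilated by
    [p p^-1], so its end is collapsed. *)
Lemma gproj_compare v p w q w' : is_path v p w -> c '1_v (gproj v p) ->
    is_path v q w' -> ~ c '1_w' 0 ->
  (exists2 r, q = p ++ r & is_path w r w') \/ (exists2 r, p = q ++ r & is_path w' r w).
Proof.
move=> pw vp qw' nw'.
have [h|[_ //]] := gpathV_path_cases qw' pw; last by case; [right | left].
case: nw'; rewrite -(gpath_conj qw') vp /gproj mulgA h.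
by rewrite !gmul0x.
Qed.

Lemma gproj_prefix v p w r w' : is_path v p w -> is_path w r w' ->
  c '1_v (gproj v (p ++ r)) -> c '1_v (gproj v p).
Proof.
move=> pw rw' h; rewrite -(gproj_source pw) {2}h (gproj_cat pw rw') 2!mulgA.
by rewrite (gproj_path pw) -(gproj_cat pw rw').
Qed.

Lemma gproj_suffix v p w r w' : is_path v p w -> is_path w r w' ->
  c '1_v (gproj v (p ++ r)) -> c '1_w (gproj w r).
Proof. by move=> pw rw' h; rewrite -(gpath_conj pw) {1}h (gproj_conj pw rw'). Qed.

Lemma related_gproj_cat v p w r w' : is_path v p w -> is_path w r w' ->
  c '1_v (gproj v p) -> c '1_w (gproj w r) -> c '1_v (gproj v (p ++ r)).
Proof. by move=> pw rw' vp wr; rewrite (gproj_cat pw rw') -wr (gpath_target pw). Qed.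

Lemma closed_pathV v m : is_path v m v -> c '1_v (gpath v m) <-> c '1_v (gpathV v m).
Proof.
move=> mv; split=> h.
  by rewrite -(gpathV_source mv) {2}h (gpathVK mv).
by rewrite -(gpath_source mv) {2}h (gpathVK mv).
Qed.

Lemma closed_gproj v m : is_path v m v -> c '1_v (gpath v m) -> c '1_v (gproj v m).
Proof.
move=> mv h; have hV := (closed_pathV mv).1 h.
by rewrite /gproj -h -hV gvertexK.
Qed.

End PathsModulo.

Section Determination.
Variable E : graph.
Local Notation G := (graph_inverse_semigroup E).
Variables (a e : congruence G) (I : G -> Prop).
Hypothesis idealI : ideal I.
Hypothesis trace_le : forall v p w, is_path v p w -> I '1_v -> ~ a '1_v 0 ->
  a '1_v (gproj v p) -> e '1_v (gproj v p).
Hypothesis closed_le : forall v m, is_path v m v -> I '1_v -> ~ a '1_v 0 ->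
  a '1_v (gpath v m) -> e '1_v (gpath v m).

Lemma ideal_path v p w : is_path v p w -> I '1_v -> I '1_w.
Proof.
by move=> pw Iv; rewrite -(gpath_conj pw); apply: idealI; left; apply: idealI; right.
Qed.

Lemma ideal_normal_form u p v q u' : is_path u p v -> is_path u' q v ->
  I (gpath u p * gpathV u' q) -> I '1_v.
Proof.
move=> pv qv Ix.
have -> : '1_v = gpathV u p * (gpath u p * gpathV u' q) * gpath u' q.
  by rewrite mulgA (gpathVK pv) -mulgA (gpathVK qv) gvertexK.
by apply: idealI; left; apply: idealI; right.
Qed.

(** The longer of [r] and [t] extends the shorter one by a closed path [m], so
    [r t^-1] is a conjugate of [m] or of [m^-1]. *)
Lemma related_of_common_source v r t w : is_path v r w -> is_path v t w ->
    I '1_v -> ~ a '1_v 0 ->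
  a '1_v (gpath v r * gpathV v t) -> e '1_v (gpath v r * gpathV v t).
Proof.
move=> rw tw Iv nv h.
have ar : a '1_v (gproj v r).
  by rewrite -(gproj_source rw) {2}h mulgA (gproj_path rw).
have at_ : a '1_v (gproj v t).
  have E1 : '1_v * gproj v t = gproj v t by rewrite /gproj mulgA (gpath_source tw).
  by rewrite -E1 {2}h /gproj -!mulgA (gpathVKV tw).
have nw : ~ a '1_w 0 by move=> w0; apply: nv; exact: gvertex_zero_gproj ar w0.
have Iw : I '1_w by exact: ideal_path rw Iv.
have er := trace_le rw Iv nv ar; have et := trace_le tw Iv nv at_.
have [[m Em mw]|[m Em mw]] := gproj_compare rw ar tw nw.
- have am : a '1_w (gpath w m).
    apply/(closed_pathV _ mw).
    rewrite -{1}(gpath_conj rw) h mulgA (gpathVK rw) Em.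
    by rewrite -mulgA (gpathV_cat_path rw mw) (gpathV_target mw).
  have /(closed_pathV _ mw) em := closed_le mw Iw nw am.
  by rewrite Em (gpathV_cat rw mw) mulgA -em (gpath_target rw).
- have am : a '1_w (gpath w m).
    rewrite -{1}(gpath_conj tw) h -!mulgA (gpathVK tw) (gpath_target rw).
    by rewrite Em (gpathV_path_cat tw mw).
  have em := closed_le mw Iw nw am.
  by rewrite Em (gpath_cat tw mw) -em (gpath_target tw).
Qed.

(** Here [r t] and [t r] are closed paths related to their sources. *)
Lemma related_of_opposite_paths v r t w : is_path v r w -> is_path w t v ->
    I '1_v -> ~ a '1_v 0 ->
  a (gpathV w t) (gpath v r) -> e (gpathV w t) (gpath v r).
Proof.
move=> rw tv Iv nv h.
have Iw : I '1_w by exact: ideal_path rw Iv.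
have nw : ~ a '1_w 0 by move=> w0; apply: nv; exact: gvertex_zero_path tv w0.
have rtv : is_path v (r ++ t) v by apply/is_path_cat; exists w.
have trw : is_path w (t ++ r) w by apply/is_path_cat; exists v.
have art : a '1_v (gpath v (r ++ t)).
  by rewrite (gpath_cat rw tv) -h (gpathVK tv).
have ert := closed_le rtv Iv nv art.
have atr : a '1_w (gpath w (t ++ r)).
  apply/(closed_pathV _ trw).
  by rewrite (gpathV_cat tv rw) h (gpathVK rw).
have etr := closed_gproj trw (closed_le trw Iw nw atr).
have et := gproj_prefix tv rw etr.
by rewrite -(gpathV_target tv) ert (gpath_cat rw tv) -mulgA -/(gproj w t) -et
  (gpath_target rw).
Qed.

(** Cancelling the common parts [p] and, on the right, the shorter of [q] and [q']
    leaves [v ~ r t^-1] or [t^-1 ~ r]. *)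
Lemma related_of_prefix u p v q u1 r v' q' u2 :
    is_path u p v -> is_path u1 q v -> is_path v r v' -> is_path u2 q' v' ->
    I (gpath u p * gpathV u1 q) -> ~ a '1_v 0 ->
    a (gpath u p * gpathV u1 q) (gpath u (p ++ r) * gpathV u2 q') ->
  e (gpath u p * gpathV u1 q) (gpath u (p ++ r) * gpathV u2 q').
Proof.
move=> pv qv rv' qv' Ix nv h.
have Iv : I '1_v by exact: ideal_normal_form Ix.
have [h0|] := gpathV_path_cases qv qv'.
  case: nv; apply: (gvertex_zero_of pv qv).
  rewrite h -(gpathVKV qv') !mulgA -h -!mulgA (mulgA (gpathV u1 q)) h0.
  by rewrite gmul0x gmulx0.
move=> [E1]; subst u2; case=> [] [t Et tv'].
- subst q'.
  have h' : a '1_v (gpath v r * gpathV v t).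
    transitivity (gpathV u p * (gpath u p * gpathV u1 q) * gpath u1 q).
      by rewrite mulgA (gpathVK pv) -mulgA (gpathVK qv) gvertexK.
    rewrite h (gpath_cat pv rv') (gpathV_cat qv tv') !mulgA (gpathVK pv).
    by rewrite (gpath_source rv') -!mulgA (gpathVK qv) (gpathV_source tv').
  have := related_of_common_source rv' tv' Iv nv h'.
  rewrite (gpath_cat pv rv') (gpathV_cat qv tv') -{1}(gpath_target pv) => h2.
  by rewrite {1}h2 !mulgA.
- subst q.
  have h' : a (gpathV v' t) (gpath v r).
    transitivity (gpathV u p * (gpath u p * gpathV u1 (q' ++ t)) * gpath u1 q').
      rewrite mulgA (gpathVK pv) (gpathV_cat qv' tv') -!mulgA (gpathVK qv').
      by rewrite (gpathV_source tv') (gpathV_target tv').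
    rewrite h (gpath_cat pv rv') !mulgA (gpathVK pv).
    by rewrite (gpath_source rv') -!mulgA (gpathVK qv') (gpath_target rv').
  have h2 := related_of_opposite_paths rv' tv' Iv nv h'.
  by rewrite (gpath_cat pv rv') (gpathV_cat qv' tv') mulgA h2.
Qed.

(** Outside of the zero class, a congruence is generated by its trace and its
    closed paths. The ideal [I] localizes the comparison with [e]: only the
    vertices in [I] occur when [x] and [y] are in [I]. *)
Lemma related_of_trace_closed x y : I x -> I y -> ~ a x 0 -> a x y -> e x y.
Proof.
move=> Ix Iy nx h.
have ny : ~ a y 0 by rewrite -h.
case: (normal_form x) Ix nx h => [_ []//|u p v q u1 pv qv] Ix nx h.
case: (normal_form y) Iy ny h => [_ []//|u' p' v' q' u1' pv' qv'] Iy ny h.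
have nv : ~ a '1_v 0 by move=> v0; apply: nx; exact: normal_form_zero v0.
have nv' : ~ a '1_v' 0 by move=> v0; apply: ny; exact: normal_form_zero v0.
have [h0|] := gpathV_path_cases pv pv'.
  case: nx; rewrite -(gpathKV pv) -!mulgA h (mulgA (gpathV u p)) h0.
  by rewrite gmul0x gmulx0.
case=> Eu; subst u'; case=> [] [r Er rv].
- by subst p'; exact: (related_of_prefix pv qv rv qv' Ix nv h).
- subst p; apply: cong_sym.
  exact: (related_of_prefix pv' qv' rv qv Iy nv' (cong_sym h)).
Qed.

End Determination.

(** * Congruences with a common zero class *)

Section SameZeroClass.
Variable E : graph.
Local Notation G := (graph_inverse_semigroup E).
Variables b d : congruence G.
Local Notation c := (d `|` b)%O.
Implicit Types (v : vertex E) (a e : congruence G) (x y : G).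

Lemma le_join_l x y : d x y -> c x y.
Proof. by have /cong_leP := leUl d b; apply. Qed.
Lemma le_join_r x y : b x y -> c x y.
Proof. by have /cong_leP := leUr b d; apply. Qed.

(** The invariant [v x y = v] says that [v x] has the form [q^-1]. A step that
    destroys it leads to some [v x'] starting with an edge. This edge is [f], as
    [f f^-1] would annihilate [v x'] otherwise; then [f f^-1] fixes [v x'], hence
    fixes [v] up to [e]. *)
Lemma edge_trace_step e v f x x' y : esource f = v -> ~ c '1_v 0 ->
    c '1_v (gproj v [:: f]) -> c '1_v x' -> e x x' -> '1_v * x * y = '1_v ->
  e '1_v (gproj v [:: f]) \/ exists y', '1_v * x' * y' = '1_v.
Proof.
move=> fv nv cf cx' exx' xy.
have cvx' : c '1_v ('1_v * x') by rewrite -cx' gvertexK.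
have [p [q [w [pw qw Ex _ _]]]] := related_to_vertex cvx' nv.
have fpath : is_path v [:: f] (erange f) by [].
case: p pw Ex => [vw|g p [gv pw]] Ex.
  right; exists (gpath v q); rewrite Ex -mulgA (gpathVK qw) vw /=.
  by rewrite gvertexK.
have [Egf|ngf] := pselect (g = f).
  subst g; left.
  have Ef : gproj v [:: f] * ('1_v * x') = '1_v * x'.
    rewrite Ex mulgA -(cat1s f p) (gpath_cat fpath pw) mulgA.
    by rewrite (gproj_path fpath).
  by rewrite -{1}xy exx' -Ef -(mulgA (gproj v [:: f])) -exx' xy (gproj_source fpath).
case: nv; rewrite -gvertexK {1}cf {1}cvx' Ex /gproj.
rewrite mulgA -(mulgA (gpath v [:: f])).
rewrite (@gpathV_path_fork _ v [::] f g [::] p (erange f) w) //.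
- by rewrite gmulx0 gmul0x.
- exact: nesym.
Qed.

(** A chain from [v] to [f f^-1] must leave the elements [q^-1] at some step, and
    that step alone relates [v] to [f f^-1]. *)
Lemma edge_trace v f : esource f = v -> ~ c '1_v 0 -> c '1_v (gproj v [:: f]) ->
  d '1_v (gproj v [:: f]) \/ b '1_v (gproj v [:: f]).
Proof.
move=> fv nv cf.
have fpath : is_path v [:: f] (erange f) by [].
pose P x := (d '1_v (gproj v [:: f]) \/ b '1_v (gproj v [:: f])) \/
  exists y, '1_v * x * y = '1_v.
have : P (gproj v [:: f]).
  move: cf (cf); rewrite -{1}/(cong_rel c _ _) => cf0.
  apply: (@cong_join_ind _ d b '1_v P).
    by right; exists '1_v; rewrite !gvertexK.
  move=> x x' cx [?|[y xy]] xx'; first by left.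
  have cx' : c '1_v x'.
    by apply: cong_trans cx _; case: xx' => [/le_join_l|/le_join_r].
  case: xx' => xx'.
    by case: (edge_trace_step fv nv cf0 cx' xx' xy); [left; left | right].
  by case: (edge_trace_step fv nv cf0 cx' xx' xy); [left; right | right].
case=> // -[y Ey]; left.
have vf : '1_v * gproj v [:: f] = gproj v [:: f].
  by rewrite /gproj mulgA (gpath_source fpath).
rewrite vf in Ey.
suff -> : gproj v [:: f] = '1_v by [].
have idem : gproj v [:: f] * gproj v [:: f] = gproj v [:: f].
  by rewrite {2}/gproj mulgA (gproj_path fpath).
by rewrite -{1}(gproj_source fpath) -{1}Ey mulgA idem Ey.
Qed.

Variable a : congruence G.
Hypotheses (da : (d <= a)%O) (abd : (a `&` b <= d)%O) (ac : (a <= c)%O).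
Hypotheses (same_zero : forall x, c x 0 -> a x 0) (zero_ab : forall x, a x 0 -> b x 0).

Lemma trace_below v p w : is_path v p w -> ~ a '1_v 0 ->
  a '1_v (gproj v p) -> d '1_v (gproj v p).
Proof.
elim: p v => [|f p IH] v /= pw nv avp; first by rewrite /gproj /= gvertexK.
case: pw => fv pw.
have fpath : is_path v [:: f] (erange f) by [].
have af := gproj_prefix fpath pw avp.
have nf : ~ a '1_(erange f) 0.
  by move=> /(gvertex_zero_gproj fpath af).
have df : d '1_v (gproj v [:: f]).
  have cf : c '1_v (gproj v [:: f]) by move: ac => /cong_leP; apply.
  have nc : ~ c '1_v 0 by move=> /same_zero.
  have [//|bf] := edge_trace fv nc cf.
  by move: abd => /cong_leP; apply.
have dp := IH _ pw nf (gproj_suffix fpath pw avp).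
exact: (related_gproj_cat fpath pw df dp).
Qed.

Section Closed.
Variable v : vertex E.
Hypothesis nv : ~ c '1_v 0.

Definition closed_at e l := is_path v l v /\ e '1_v (gpath v l).

Lemma closed_at_nil e : closed_at e [::].
Proof. by []. Qed.

Lemma closed_at_cat e l m : closed_at e l -> closed_at e m -> closed_at e (l ++ m).
Proof.
move=> [lv el] [mv em]; split; first by apply/is_path_cat; exists v.
by rewrite (gpath_cat lv mv) -el -em gvertexK.
Qed.

Lemma closed_at_compare l m : closed_at c l -> closed_at c m ->
  (exists2 r, m = l ++ r & is_path v r v) \/ (exists2 r, l = m ++ r & is_path v r v).
Proof. by move=> [lv cl] [mv _]; exact: (gproj_compare lv (closed_gproj lv cl) mv). Qed.

(** Both products are closed paths related to [v], so they are comparable, and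
    they have the same length. *)
Lemma closed_at_comm l m : closed_at c l -> closed_at c m -> l ++ m = m ++ l.
Proof.
move=> cl cm.
have sz : size (l ++ m) = size (m ++ l) by rewrite !size_cat addnC.
have nil_r (X Y r : seq (edge E)) : size X = size Y -> Y = X ++ r -> X = Y.
  move=> szXY EY; move: szXY; rewrite EY size_cat -[LHS]addn0 => /addnI/esym/size0nil ->.
  by rewrite cats0.
have := closed_at_compare (closed_at_cat cl cm) (closed_at_cat cm cl).
by case=> [] [r Er _]; [|symmetry]; exact: (nil_r _ _ r).
Qed.

(** In the group of fractions of the closed paths at [v], this says that [l / m]
    is a product of a quotient of [d]-closed paths and a quotient of [b]-closed
    paths. *)
Definition commensurate l m := exists al be ga de,
  [/\ closed_at d al, closed_at d be, closed_at b ga, closed_at b de &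
      l ++ al ++ ga = m ++ be ++ de].

Lemma closed_at_le_l l : closed_at d l -> closed_at c l.
Proof. by move=> [lv /le_join_l]. Qed.
Lemma closed_at_le_r l : closed_at b l -> closed_at c l.
Proof. by move=> [lv /le_join_r]. Qed.

Lemma closed_at_cancel e l r : is_path v l v -> is_path v r v ->
  e (gpath v l) (gpath v (l ++ r)) -> closed_at e r.
Proof.
move=> lv rv h; split=> //.
by rewrite -(gpathV_path_cat lv rv) -h (gpathVK lv).
Qed.

Lemma commensurate_step l l' m : closed_at c l -> closed_at c l' -> closed_at c m ->
    d (gpath v l) (gpath v l') \/ b (gpath v l) (gpath v l') ->
  commensurate l m -> commensurate l' m.
Proof.
move=> cl cl' cm ll' [al [be [ga [de [dal dbe bga bde El]]]]].
have [cal cbe] := (closed_at_le_l dal, closed_at_le_l dbe).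
have [[t Et tv]|[t Et tv]] := closed_at_compare cl cl'; subst.
- case: ll' => /(closed_at_cancel cl.1 tv) et.
    have ct := closed_at_le_l et.
    exists al, (t ++ be), ga, de; split=> //; first exact: closed_at_cat.
    by rewrite (closed_at_comm cl ct) -!catA El !catA (closed_at_comm cm ct).
  have ct := closed_at_le_r et.
  exists al, be, ga, (t ++ de); split=> //; first exact: closed_at_cat.
  rewrite (closed_at_comm cl ct) -!catA El !catA (closed_at_comm ct cm) -!catA.
  by rewrite (catA t) (closed_at_comm ct cbe) -!catA.
- case: ll' => /cong_sym/(closed_at_cancel cl'.1 tv) et.
    by exists (t ++ al), be, ga, de; split; rewrite -?catA -?El -?catA //;
      exact: closed_at_cat.
  have ct := closed_at_le_r et.
  exists al, be, (t ++ ga), de; split=> //; first exact: closed_at_cat.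
  by rewrite -El -!catA (catA al) (closed_at_comm cal ct) -!catA.
Qed.

Variable s : seq (edge E).
Hypotheses (cs : closed_at c s) (s_neq0 : s <> [::]).

Definition pow k := flatten (nseq k s).

Lemma powD k j : pow (k + j) = pow k ++ pow j.
Proof. by rewrite /pow nseqD flatten_cat. Qed.

Lemma closed_at_pow e k : closed_at e s -> closed_at e (pow k).
Proof.
by move=> es; elim: k => [|k IH]; [exact: closed_at_nil | exact: closed_at_cat].
Qed.

Lemma size_pow k : k <= size (pow k).
Proof.
elim: k => // k IH; rewrite /pow /= size_cat -/(pow k) -add1n leq_add //.
by case: s s_neq0.
Qed.

Lemma prefix_pow q w : is_path v q w -> c '1_v (gproj v q) ->
  exists2 r, pow (size q) = q ++ r & is_path w r v.
Proof.
move=> qw cq; have [pv cp] := closed_at_pow (size q) cs.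
have [//|[r Er rw]] := gproj_compare qw cq pv nv.
exists [::].
  have := size_pow (size q); rewrite {1}Er size_cat -[leqRHS]addn0 leq_add2l leqn0.
  by move=> /nilP r0; rewrite {2}Er r0 !cats0.
have := size_pow (size q); rewrite {1}Er size_cat -[leqRHS]addn0 leq_add2l leqn0.
by move=> /nilP r0; rewrite r0 in rw.
Qed.

(** Multiplying by a large power of [s] turns every element related to the
    vertex into a closed path, so the chain from the vertex to [s] becomes a
    chain of closed paths, which commute. *)
Lemma chain_commensurate x : c '1_v x -> exists k l,
  [/\ closed_at c l, '1_v * x * gpath v (pow k) = gpath v l & commensurate l (pow k)].
Proof.
move: x; apply: cong_join_ind.
  exists 0%N, [::]; split=> //=; first by rewrite !gvertexK.
  by exists [::], [::], [::], [::].
move=> x1 x2 cx1 [k [l [cl El bl]]] x12.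
have cx2 : c '1_v ('1_v * x2).
  rewrite -{1}gvertexK; apply: cong_mull; apply: cong_trans cx1 _.
  by case: x12 => [/le_join_l|/le_join_r].
have [p [q [w [pw qw Ex _ cq]]]] := related_to_vertex cx2 nv.
have [r Er rv] := prefix_pow qw cq.
have [cpk cpj] := (closed_at_pow k cs, closed_at_pow (size q) cs).
have prv : is_path v (p ++ r) v by apply/is_path_cat; exists w.
have Epr : '1_v * x2 * gpath v (pow (size q)) = gpath v (p ++ r).
  by rewrite Ex Er -mulgA (gpathV_path_cat qw rv) (gpath_cat pw rv).
(* The exponents of both sides are brought to the common value [k + size q]. *)
have cpr : closed_at c (p ++ r) by split=> //; rewrite -Epr -cx2 -cpj.2 gvertexK.
have Ex1 : '1_v * x1 * gpath v (pow (k + size q)) = gpath v (l ++ pow (size q)).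
  by rewrite powD (gpath_cat cpk.1 cpj.1) mulgA El (gpath_cat cl.1 cpj.1).
have Ex2 : '1_v * x2 * gpath v (pow (k + size q)) = gpath v ((p ++ r) ++ pow k).
  by rewrite addnC powD (gpath_cat cpj.1 cpk.1) mulgA Epr (gpath_cat prv cpk.1).
exists (k + size q)%N, ((p ++ r) ++ pow k); split=> //.
  exact: closed_at_cat.
apply: (@commensurate_step (l ++ pow (size q))).
- exact: closed_at_cat.
- exact: closed_at_cat.
- exact: closed_at_pow.
- rewrite -Ex1 -Ex2.
  by case: x12 => h; [left | right]; apply: cong_mulr; exact: cong_mull.
- case: bl => al [be [ga [de [dal dbe bga bde El']]]].
  exists al, be, ga, de; split=> //.
  by rewrite (closed_at_comm cl cpj) -catA El' catA -powD addnC.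
Qed.

(** Commensurability of [s^(k+1)] and [s^k] gives [s al ga = be de]. As [a]
    relates [s], [al] and [be] to [v], it relates [ga] to [de]; so does [b], hence
    so does [d]. Then [s ga ~ ga] in [d], and [ga] cancels on the right because
    [v ~ ga ga^-1]. *)
Lemma closed_below_nonempty : closed_at a s -> d '1_v (gpath v s).
Proof.
move=> as_; have [sv cvs] := cs.
have [k [l [cl El bl]]] := chain_commensurate cvs.
have cpk := closed_at_pow k cs.
have := bl; have csk : closed_at c (s ++ pow k) by exact: closed_at_cat.
rewrite (gpath_source sv) -(gpath_cat sv cpk.1) in El.
have {bl El}/(commensurate_step cl csk cpk) : d (gpath v l) (gpath v (s ++ pow k)) \/
    b (gpath v l) (gpath v (s ++ pow k)) by left; rewrite El.
move=> /[apply] -[al [be [ga [de [dal dbe bga bde]]]]].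
rewrite (closed_at_comm cs cpk) -catA => /(congr1 (drop (size (pow k)))).
rewrite !drop_size_cat // => Es.
have aa l' : closed_at d l' -> a '1_v (gpath v l').
  by case=> _ ?; move: da => /cong_leP; apply.
have El' : gpath v s * gpath v al * gpath v ga = gpath v be * gpath v de.
  rewrite -(gpath_cat dbe.1 bde.1) -Es -mulgA.
  rewrite -(gpath_cat dal.1 bga.1) -(gpath_cat sv (w := v)) //.
  by apply/is_path_cat; exists v; [exact: dal.1 | exact: bga.1].
have agd : a (gpath v ga) (gpath v de).
  rewrite -(gpath_source bga.1) -(gpath_source bde.1) {2}(aa _ dbe) -El'.
  by rewrite -as_.2 -(aa _ dal) gvertexK.
have dgd : d (gpath v ga) (gpath v de).
  move: abd => /cong_leP; apply; split=> //.
  by rewrite -bga.2 -bde.2.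
have dsg : d (gpath v s * gpath v ga) (gpath v ga).
  rewrite -{1}(gpath_source bga.1) {1}dal.2 mulgA El' -dbe.2 dgd.
  by rewrite (gpath_source bde.1).
have dga : d '1_v (gproj v ga).
  apply: (trace_below bga.1).
    by move=> av; apply: nv; move: ac => /cong_leP; apply.
  have [r Er rv] := prefix_pow bga.1 (closed_gproj bga.1 (closed_at_le_r bga).2).
  apply: (gproj_prefix bga.1 rv); rewrite -Er.
  have apow := closed_at_pow (size ga) as_.
  exact: closed_gproj apow.1 apow.2.
by rewrite -(gpath_target sv) {2}dga /gproj mulgA dsg -/(gproj v ga).
Qed.

End Closed.

Lemma closed_below v m : is_path v m v -> ~ a '1_v 0 ->
  a '1_v (gpath v m) -> d '1_v (gpath v m).
Proof.
move=> mv nv am; have [->//|m0] := pselect (m = [::]).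
apply: closed_below_nonempty => //.
- by move=> /same_zero.
- by split=> //; move: ac => /cong_leP; apply.
Qed.

(** The modular law for congruences with the same zero class. *)
Lemma modular_below : (a <= d)%O.
Proof.
apply/cong_leP => x y axy.
have d0 u : a u 0 -> d u 0.
  by move=> au; move: abd => /cong_leP; apply; split=> //; exact: zero_ab.
have [ax0|nax] := pselect (a x 0).
  by rewrite (d0 _ ax0) (d0 y) // -axy.
apply: (@related_of_trace_closed _ a d (fun=> True)) axy => //.
- by move=> v p w pw _; exact: trace_below pw.
- by move=> v m mv _; exact: closed_below mv.
Qed.

End SameZeroClass.

(** * Graphs without forked vertices *)

Section NoForks.
Variable E : graph.
Local Notation G := (graph_inverse_semigroup E).
Implicit Types (a b c d : congruence G) (u v w : vertex E) (x y : G).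

Lemma exit_zero (c : congruence G) v e g : c '1_v (gproj v [:: e]) ->
  esource e = v -> esource g = v -> g <> e -> c '1_(erange g) 0.
Proof.
move=> ce ev gv nge.
have gpath_ : is_path v [:: g] (erange g) by [].
rewrite -(gpath_conj gpath_) ce /gproj (mulgA (gpathV v [:: g])).
rewrite (@gpathV_path_fork _ v [::] g e [::] [::] (erange g) (erange e)) //.
by rewrite !gmul0x.
Qed.

(** Where [p] and [q] diverge into edges [e] and [f], every exit other than [e] is
    killed by [a], and [r(e)] survives in [a]; the same holds for [f] and [b]. *)
Lemma forked_of_diverging a b v p w q w' :
    ~ a '1_v 0 -> ~ b '1_v 0 ->
    is_path v p w -> a '1_v (gproj v p) -> b '1_w 0 ->
    is_path v q w' -> b '1_v (gproj v q) -> a '1_w' 0 ->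
  exists u : vertex E, forked u.
Proof.
elim: p q v => [|e p IH] q v nav nbv.
  by move=> /= <- _ /nbv.
case: q => [|f q]; first by move=> _ _ _ /= <- _ /nav.
move=> [ev pw] ap bw [fv qw'] bq aw'.
have epath : is_path v [:: e] (erange e) by [].
have fpath : is_path v [:: f] (erange f) by [].
have ae := gproj_prefix epath pw ap; have bf := gproj_prefix fpath qw' bq.
have nae : ~ a '1_(erange e) 0 by move=> /(gvertex_zero_gproj epath ae).
have nbf : ~ b '1_(erange f) 0 by move=> /(gvertex_zero_gproj fpath bf).
have [Eef|nef] := pselect (e = f).
  subst f; apply: (IH q (erange e)) => //.
  - exact: (gproj_suffix epath pw ap).
  - exact: (gproj_suffix epath qw' bq).
exists v, e, f; split=> //.
- move=> g gv nge [r rp]; apply: nae; apply: gvertex_zero_path rp _.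
  exact: (exit_zero ae).
- move=> g gv ngf [r rp]; apply: nbf; apply: gvertex_zero_path rp _.
  exact: (exit_zero bf).
Qed.

Lemma related_to_zero_class a b v x : b '1_v x -> a x 0 -> ~ b '1_v 0 ->
  exists p w, [/\ is_path v p w, b '1_v (gproj v p) & a '1_w 0].
Proof.
move=> vx ax nv; have [p [q [w [pw qw Ex bp _]]]] := related_to_vertex vx nv.
by exists p, w; split=> //; apply: (gvertex_zero_of pw qw); rewrite -Ex.
Qed.

Lemma zero_class_union a b c : ~ (exists v : vertex E, forked v) ->
    (forall x, c x 0 -> exists2 x', a x' 0 & b x x') ->
    (forall x, c x 0 -> exists2 x', b x' 0 & a x x') ->
  forall x, c x 0 -> a x 0 \/ b x 0.
Proof.
move=> noforks satb sata x; case: (normal_form x) => [|u p v q u' pv qv] cx; first by left.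
have cv := gvertex_zero_of pv qv cx.
have [av|nav] := pselect (a '1_v 0); first by left; exact: normal_form_zero av.
have [bv|nbv] := pselect (b '1_v 0); first by right; exact: normal_form_zero bv.
have [x1 ax1 bx1] := satb _ cv; have [x2 bx2 ax2] := sata _ cv.
have [q' [w' [qw bq aw]]] := related_to_zero_class bx1 ax1 nbv.
have [p' [w [pw ap bw]]] := related_to_zero_class ax2 bx2 nav.
by case: noforks; exact: (forked_of_diverging nav nbv pw ap bw qw bq aw).
Qed.

(** From each vertex in [Z_c] outside of [Z_a], there is a path [k] into [Z_a] with
    [v ~ k k^-1] in [b], and every path that survives in [b] is comparable with
    [k]. So paths that survive in [a] are initial segments of [k]: their length is
    bounded, which excludes the powers of a nonempty closed path, and their trace
    is inherited from [k]. *)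
Lemma nested_zero_class a b c : (forall x, b x 0 -> a x 0) ->
    (forall x, c x 0 -> exists2 x', a x' 0 & b x x') ->
  forall x y, c x 0 -> c y 0 -> ~ a x 0 -> a x y -> b x y.
Proof.
move=> ba satb x y cx cy nax axy.
have exit_path v : c '1_v 0 -> ~ a '1_v 0 ->
    exists p w, [/\ is_path v p w, b '1_v (gproj v p) & a '1_w 0].
  move=> cv nav; have [x1 ax1 bx1] := satb _ cv.
  by apply: related_to_zero_class bx1 ax1 _ => /ba.
apply: (@related_of_trace_closed _ a b (zero_class 0 c)) axy => //.
- by apply: zero_class_ideal; [exact: gmul0x | exact: gmulx0].
- move=> v p w pw cv nav ap.
  have [k [w' [kw bk aw]]] := exit_path _ cv nav.
  have naw : ~ a '1_w 0 by move=> /(gvertex_zero_gproj pw ap).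
  have nbw : ~ b '1_w 0 by move=> /ba.
  have [[r Er rw]|[r Er rw]] := gproj_compare kw bk pw nbw.
    by case: naw; exact: gvertex_zero_path rw aw.
  by rewrite Er in bk; exact: (gproj_prefix pw rw bk).
- move=> v m mv cv nav am; have [->//|m0] := pselect (m = [::]).
  have [k [w [kw bk aw]]] := exit_path _ cv nav.
  have nbv : ~ b '1_v 0 by move=> /ba.
  have [lv _] := closed_at_pow (size k) (conj mv am : closed_at v a m).
  have [[r Er rw]|[r Er rw]] := gproj_compare kw bk lv nbv.
    by case: nav; exact: gvertex_zero_path rw aw.
  have := size_pow m0 (size k); rewrite {1}Er size_cat -[leqRHS]addn0 leq_add2l leqn0.
  by move=> /nilP r0; rewrite r0 /= in rw; case: nav; rewrite rw.
Qed.

Lemma cover_same_zero_class a b :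
    covered_by a (a `|` b)%O -> covered_by b (a `|` b)%O ->
    (forall x, (a `|` b)%O x 0 -> a x 0) -> (forall x, (a `|` b)%O x 0 -> b x 0) ->
  covered_by (a `&` b)%O a.
Proof.
move=> /covered_byP[ac _] /covered_byP[bc covb] za zb; apply/covered_byP; split.
  rewrite lt_leAnge leIl lexI lexx /=; apply/negP => /join_r Ej.
  by rewrite Ej ltxx in bc.
move=> d id da.
have le_c : (d `|` b <= a `|` b)%O by rewrite leU2.
have := covb _ (leUr b d) le_c; case=> h.
  by left; rewrite lexI da (le_trans (leUl d b)).
right; apply: (@modular_below E b d a da id).
- by apply: le_trans h; exact: leUl.
- by move=> x dx; apply: za; move: le_c => /cong_leP; apply.
- by move=> x ax; apply: zb; have /cong_leP := leUl a b; apply.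
Qed.

(** Since [b] does not kill [Z_a], collapsing [Z_a] leads from [b] to the join;
    hence everything that the join kills is [b]-related to [Z_a]. *)
Lemma covers_of_not_subset a b : ~ (exists v : vertex E, forked v) ->
    covered_by a (a `|` b)%O -> covered_by b (a `|` b)%O ->
    ~ (forall x, (a `|` b)%O x 0 -> a x 0) -> ~ (forall x, (a `|` b)%O x 0 -> b x 0) ->
    ~ (forall x, a x 0 -> b x 0) ->
  covered_by (a `&` b)%O a /\ covered_by (a `&` b)%O b.
Proof.
move=> noforks cova covb nza nzb nab.
have /cong_leP lea := leUl a b; have /cong_leP leb := leUr b a.
have sat a1 b1 : covered_by b1 (a `|` b)%O -> (forall x, a1 x 0 -> (a `|` b)%O x 0) ->
    ~ (forall x, a1 x 0 -> b1 x 0) ->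
    forall x, (a `|` b)%O x 0 -> exists2 x', a1 x' 0 & b1 x x'.
  move=> cov le1 n1 x cx.
  have idl : ideal (zero_class 0 a1) by apply: zero_class_ideal; [exact: gmul0x | exact: gmulx0].
  have [b1x|[//]] := covered_by_saturation cov idl (zero_class_zero _ _) le1 n1 cx.
  by exists 0; first exact: cong_refl.
have satb := sat a b covb (fun x => lea x 0) nab.
apply: (meet_covered_criterion (gmul0x (E := E)) (gmulx0 (E := E))) => // x y axy.
have [cx|[]] := covered_by_zero_class (gmul0x (E := E)) (gmulx0 (E := E)) covb nzb (lea _ _ axy).
  by left.
move=> cx cy.
have [ax|nax] := pselect (a x 0).
  by right; split=> //; rewrite /zero_class -axy.
left; have [ba|nba] := pselect (forall x, b x 0 -> a x 0).
  exact: nested_zero_class cx cy nax axy.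
have sata := sat b a cova (fun x => leb x 0) nba.
have U := zero_class_union noforks satb sata.
have nay : ~ a y 0 by rewrite -axy.
case: (U _ cx) => // bx; case: (U _ cy) => // by_.
by rewrite bx by_.
Qed.

Lemma lower_semimodular_of_no_forks : ~ (exists v : vertex E, forked v) ->
  lower_semimodular (congruence G).
Proof.
move=> noforks a b cova covb.
have [za|nza] := pselect (forall x, (a `|` b)%O x 0 -> a x 0).
  have [zb|nzb] := pselect (forall x, (a `|` b)%O x 0 -> b x 0).
    split; first exact: cover_same_zero_class.
    by rewrite meetC; apply: cover_same_zero_class; rewrite joinC.
  have /cong_leP lea := leUl a b.
  apply: (meet_covered_criterion (gmul0x (E := E)) (gmulx0 (E := E))) => // x y /lea cxy.
  have [bxy|[cx cy]] := covered_by_zero_class (gmul0x (E := E)) (gmulx0 (E := E)) covb nzb cxy.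
    by left.
  by right; split; exact: za.
rewrite meetC; apply/and_comm.
move: cova covb nza; rewrite joinC => cova covb nza.
have [zb|nzb] := pselect (forall x, (b `|` a)%O x 0 -> b x 0).
  have /cong_leP leb := leUl b a.
  apply: (meet_covered_criterion (gmul0x (E := E)) (gmulx0 (E := E))) => // x y /leb cxy.
  have [axy|[cx cy]] := covered_by_zero_class (gmul0x (E := E)) (gmulx0 (E := E)) cova nza cxy.
    by left.
  by right; split; exact: zb.
have [ba|nba] := pselect (forall x, b x 0 -> a x 0); last first.
  exact: covers_of_not_subset.
have [ab|nab] := pselect (forall x, a x 0 -> b x 0); last first.
  rewrite meetC; apply/and_comm; apply: covers_of_not_subset => //; by rewrite joinC.
case: nzb => x; apply: zero_class_join => y.
by split; [exact: ba | exact: ab].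
Qed.

End NoForks.

(** * Separating normal forms by an action on paths *)

Section PathAction.
Variable E : graph.
Local Notation G := (graph_inverse_semigroup E).
Implicit Types (u v w : vertex E) (l : seq (edge E)) (x y : G) (K : vertex E -> Prop).

(** The semigroup acts by partial injections on the paths ending at [w]: an edge
    is prepended, and its inverse strips it. As the end of a path never changes,
    the elements acting as the empty map on all paths that end outside of a given
    set of vertices form an ideal. *)
Fixpoint term_act w (t : term E) l : option (seq (edge E)) :=
  match t with
  | TZero => None
  | TVertex v => if `[< is_path v l w >] then Some l else None
  | TEdge e => if `[< is_path (erange e) l w >] then Some (e :: l) else None
  | TInv e => if l is f :: l' then
      if `[< f = e /\ is_path (erange e) l' w >] then Some l' else None else None
  | TMul s t => obind (term_act w s) (term_act w t l)
  end.

Lemma is_path_source_eq u v l w : is_path u l w -> is_path v l w -> u = v.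
Proof. by case: l => [|e l] /=; [move=> -> -> | move=> [<- _] [<- _]]. Qed.

Lemma term_act_eq w s t : term_eq s t -> forall l, term_act w s l = term_act w t l.
Proof.
elim=> {s t}.
- by [].
- by move=> s t _ IH l; rewrite IH.
- by move=> s t r _ IH1 _ IH2 l; rewrite IH1.
- move=> s s' t t' _ IH1 _ IH2 l /=; rewrite IH2; case: (term_act _ _ _) => //=.
- by move=> s t r l /=; case: (term_act w r l).
- by move=> t l /=; case: (term_act w t l).
- by [].
- move=> v u l /=; rewrite /kronecker; case: asboolP => [uw|nuw] /=.
    case: asboolP => [vw|nvw]; case: asboolP => [E1|nE] //=.
    + by rewrite asboolT.
    + by case: nE; exact: is_path_source_eq vw uw.
    + by subst; case: nvw.
  by case: asboolP => // E1 /=; rewrite asboolF // E1.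
- by move=> e l /=; case: asboolP => //= ew; rewrite asboolT.
- by move=> e l /=; case: asboolP => //= ew; rewrite asboolT.
- move=> e [|f l] //=; case: asboolP => //= -[_ ew]; by rewrite asboolT.
- move=> e [|f l] /=; first by case: asboolP.
  case: asboolP => /= [[fe fw]|nfw].
    by [].
  by case: asboolP => // -[Efe ew]; case: nfw; rewrite Efe.
- move=> e f l /=; rewrite /kronecker; case: asboolP => [fw|nfw] /=.
    case: asboolP => [[Efe ew]|ne].
      by rewrite asboolT //= asboolT.
    by case: asboolP => // Eef; case: ne; rewrite Eef.
  by case: asboolP => // Eef /=; rewrite asboolF // Eef.
Qed.

Definition gact w x l := term_act w (gis_repr x) l.

Lemma gactE w t l : gact w (gis_class t) l = term_act w t l.
Proof. by apply: term_act_eq; apply/gis_classP; exact: gis_reprK. Qed.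

Lemma gactM w x y l : gact w (x * y) l = obind (gact w x) (gact w y l).
Proof. by rewrite -{1}(gis_reprK x) -{1}(gis_reprK y) gmulE gactE. Qed.

(** The action only sees an initial segment of a path. *)
Lemma gact_cat w x l l' r w' : is_path w r w' -> gact w x l = Some l' ->
  gact w' x (l ++ r) = Some (l' ++ r).
Proof.
move=> rw; rewrite /gact; elim: (gis_repr x) l l' => //=.
- move=> v l l'; case: asboolP => // lw [<-]; rewrite asboolT //.
  by apply/is_path_cat; exists w.
- move=> e l l'; case: asboolP => // lw [<-]; rewrite asboolT //.
  by apply/is_path_cat; exists w.
- move=> e [//|f l] l' /=; case: asboolP => // -[Ef lw] [<-]; rewrite asboolT //.
  by split=> //; apply/is_path_cat; exists w.
- move=> s IHs t IHt l l'; case Et: (term_act w t l) => [l1|//] /= /IHs.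
  by rewrite (IHt _ _ Et).
Qed.

Lemma gact_vertex w v l : gact w '1_v l = if `[< is_path v l w >] then Some l else None.
Proof. exact: gactE. Qed.

Lemma gact_gproj1 w v e l : gact w (gproj v [:: e]) l =
  if l is f :: l' then
    if `[< f = e /\ is_path (erange e) l' w >] then Some l else None else None.
Proof.
have -> : gproj v [:: e] = gedge e * ginv e.
  by rewrite /gproj /= !mulgA -(mulgA (gedge e)) gvertexK gedge_range.
rewrite gactM !gactE; case: l => [//|f l] /=.
by case: asboolP => //= -[-> ew]; rewrite gactE /= asboolT.
Qed.

Definition kills K x := forall w l, ~ K w -> gact w x l = None.

Lemma kills_ideal K : ideal (kills K).
Proof.
move=> x y xy w l nKw; rewrite gactM; case: xy => H; last by rewrite H.
by case: (gact w y l) => //= l'; rewrite H.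
Qed.

Lemma kills_zero K : kills K 0.
Proof. by move=> w l _; exact: gactE. Qed.

Lemma kills_sub K K' x : (forall w, K w -> K' w) -> kills K x -> kills K' x.
Proof. by move=> KK' Kx w l nK'; apply: Kx => /KK'. Qed.

Lemma kills_vertex K v : (forall u w, K u -> reaches u w -> K w) ->
  kills K '1_v <-> K v.
Proof.
move=> hered; split=> [Kv|Kv w l nKw].
  apply: contrapT => /(Kv v [::]); rewrite gact_vertex asboolT //.
by rewrite gact_vertex asboolF // => lw; apply: nKw; apply: hered Kv _; exists l.
Qed.

End PathAction.

Section SyntacticCongruence.
Variable S : semigroupType.

Program Definition cong_eq : congruence S := @Congruence S eq _ _ _ _ _.

(** When every element has a left and a right unit, this is the largest congruence
    for which [I] is a union of classes. *)
Program Definition syntactic (I : S -> Prop) : congruence S :=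
  @Congruence S (fun x y => forall p q, I (p * x * q) <-> I (p * y * q)) _ _ _ _ _.
Next Obligation. by []. Qed.
Next Obligation. exact: iff_sym (H p q). Qed.
Next Obligation. exact: iff_trans (H p q) (H0 p q). Qed.
Next Obligation. by move: (H (p * z) q); rewrite !mulgA. Qed.
Next Obligation. by move: (H p (z * q)); rewrite !mulgA. Qed.

End SyntacticCongruence.

Section Fork.
Variable E : graph.
Local Notation G := (graph_inverse_semigroup E).
Variable v : vertex E.
Implicit Types (u w : vertex E) (e f g : edge E) (x y : G).

Lemma reaches_refl u : reaches u u.
Proof. by exists [::]. Qed.

Lemma reaches_trans u1 u2 u3 : reaches u1 u2 -> reaches u2 u3 -> reaches u1 u3.
Proof. by move=> [p pu] [q qu]; exists (p ++ q); apply/is_path_cat; exists u2. Qed.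

Lemma reaches_edge e : esource e = v -> reaches v (erange e).
Proof. by move=> ev; exists [:: e]. Qed.

Definition avoiding e u := reaches v u /\ ~ reaches u (erange e).

Lemma avoiding_hereditary e u w : avoiding e u -> reaches u w -> avoiding e w.
Proof.
move=> [vu nue] uw; split; first exact: reaches_trans uw.
by move=> we; apply: nue; exact: reaches_trans we.
Qed.

Definition reach_collapse : congruence G :=
  rees_join (cong_eq G) (@kills_ideal E (reaches v)).

Lemma reach_collapseP x y :
  reach_collapse x y <-> x = y \/ (kills (reaches v) x /\ kills (reaches v) y).
Proof.
by split=> [[|[[k Kk ->] [l Kl ->]]]|[|[Kx Ky]]]; [left|right|left|right; split; [exists x|exists y]].
Qed.

(** The ideal of the avoiding set remains a union of classes: anything larger has
    to kill [r(e)]. *)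
Definition coatom e : congruence G :=
  (reach_collapse `&` syntactic (kills (avoiding e)))%O.

Lemma coatom_le_collapse e : (coatom e <= reach_collapse)%O.
Proof. exact: leIl. Qed.

Lemma coatom_of_kills e x : kills (avoiding e) x -> coatom e x 0.
Proof.
move=> Kx; split.
  apply/reach_collapseP; right; split; last exact: kills_zero.
  by apply: kills_sub Kx => w [].
move=> p q; split=> _.
  by rewrite gmulx0 gmul0x; exact: kills_zero.
by apply: kills_ideal; left; apply: kills_ideal; right.
Qed.

Lemma coatom_vertex_zero e u : coatom e '1_u 0 -> avoiding e u.
Proof.
move=> [_ /(_ '1_u '1_u) [_]]; rewrite gmulx0 gmul0x !gvertexK => H.
apply/(kills_vertex _ (@avoiding_hereditary e)); apply: H; exact: kills_zero.
Qed.

Lemma coatom_zero_vertex e u : avoiding e u -> coatom e '1_u 0.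
Proof. by move=> eu; apply: coatom_of_kills; apply/kills_vertex => //; exact: avoiding_hereditary. Qed.

(** Replacing [v] by [e e^-1] inside a product only affects paths from [v] that do
    not start with [e]. Those starting with another edge end in the avoiding set,
    as [e] is isolated; the empty path at [v] is witnessed by its extension
    [e]. *)
Lemma coatom_trace e : esource e = v -> isolated_exit v e ->
  coatom e '1_v (gproj v [:: e]).
Proof.
move=> ev iso.
have epath : is_path v [:: e] (erange e) by [].
have Kv : kills (reaches v) '1_v.
  by apply/kills_vertex; [exact: reaches_trans | exact: reaches_refl].
split.
  apply/reach_collapseP; right; split=> //; rewrite -(gproj_source epath).
  by apply: kills_ideal; right.
move=> p q; split=> H w l nKw.
  have {H} := H w l nKw; rewrite !gactM; case: (gact w q l) => [l1|//] /=.
  rewrite 2!(gactM _ p) gact_vertex gact_gproj1; case: l1 => [//|g l1] /=.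
  case: (asboolP (g = e /\ _)) => [[-> lw]|//].
  by rewrite asboolT.
have HH := H w l nKw; move: HH; rewrite !gactM; case Eq: (gact w q l) => [l1|//] /=.
rewrite 2!(gactM _ p) gact_vertex gact_gproj1; case: asboolP => [l1w|//] /=.
case: l1 Eq l1w => [|g l1] Eq l1w; last first.
  case: asboolP => [//|ng _]; case: l1w => gv l1w.
  have [Ege|nge] := pselect (g = e); first by case: ng; rewrite -Ege.
  case: nKw; split.
    by exists (g :: l1).
  by move=> we; apply: (iso g gv nge); apply: reaches_trans we; exists l1.
move=> _; rewrite /= in l1w; subst w.
case Ep: (gact v p [::]) => [l3|//].
have nKe : ~ avoiding e (erange e) by case=> _; apply; exact: reaches_refl.
move: (H _ (l ++ [:: e]) nKe); rewrite !gactM (gact_cat epath Eq) /=.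
by rewrite gactM gact_gproj1 asboolT //= (gact_cat epath Ep).
Qed.

Lemma zero_of_reached e d x : esource e = v -> isolated_exit v e ->
  (coatom e <= d)%O -> d '1_(erange e) 0 -> kills (reaches v) x -> d x 0.
Proof.
move=> ev iso /cong_leP le_d de Kx.
have epath : is_path v [:: e] (erange e) by [].
have dv : d '1_v 0.
  exact: (gvertex_zero_gproj epath (le_d _ _ (coatom_trace ev iso)) de).
case: (normal_form x) Kx => [_|u p w q u' pw qw Kx]; first exact: cong_refl.
apply: (normal_form_zero pw qw).
have [r rw] : reaches v w.
  apply/(kills_vertex _ (@reaches_trans v)).
  exact: (ideal_normal_form (@kills_ideal E _) pw qw Kx).
exact: gvertex_zero_path rw dv.
Qed.

(** By maximality of the syntactic congruence, a [d] that is not below the coatom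
    kills some vertex outside of the avoiding set, hence [r(e)], hence [v]. *)
Lemma coatom_maximal e d : esource e = v -> isolated_exit v e ->
    (coatom e <= d)%O -> (d <= reach_collapse)%O ->
  (d <= coatom e)%O \/ (reach_collapse <= d)%O.
Proof.
move=> ev iso le_d d_le; have /cong_leP d_leP := d_le.
have [|nle] := pselect (d <= coatom e)%O; [by left | right].
have key p q x y : d x y -> kills (avoiding e) (p * x * q) ->
    ~ kills (avoiding e) (p * y * q) -> d '1_(erange e) 0.
  move=> dxy Kx nKy.
  have dxy' : d (p * x * q) (p * y * q) by apply: cong_mulr; exact: cong_mull.
  have dy0 : d (p * y * q) 0.
    apply: cong_trans (cong_sym dxy') _.
    by move/cong_leP: le_d; apply; exact: coatom_of_kills.
  case/reach_collapseP: (d_leP _ _ dxy') => [Exy|[_ Ky]]; first by case: nKy; rewrite -Exy.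
  move: (p * y * q) nKy dy0 Ky {dxy'} => t.
  case: (normal_form t) => [|u k w l u' kw lw] nKt dt Kt.
    by case: nKt; exact: kills_zero.
  have dw := gvertex_zero_of kw lw dt.
  have vw : reaches v w.
    apply/(kills_vertex _ (@reaches_trans v)).
    exact: (ideal_normal_form (@kills_ideal E _) kw lw Kt).
  have [[r rw]|nwe] := pselect (reaches w (erange e)); first exact: gvertex_zero_path rw dw.
  case: nKt; rewrite -(gpath_target kw); apply: kills_ideal; left.
  apply: kills_ideal; right.
  by apply/(kills_vertex _ (@avoiding_hereditary e)).
have de : d '1_(erange e) 0.
  apply: contrapT => nde; apply: nle; apply/cong_leP => x y dxy; split; first exact: d_leP.
  move=> p q; split=> K1; apply: contrapT => K2; apply: nde.
    exact: key dxy K1 K2.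
  exact: key (cong_sym dxy) K1 K2.
apply/cong_leP => x y /reach_collapseP[->|[Kx Ky]]; first exact: cong_refl.
have dx := zero_of_reached ev iso le_d de Kx.
have dy := zero_of_reached ev iso le_d de Ky.
by rewrite dx dy.
Qed.

Lemma coatom_join e f : esource e = v -> esource f = v -> e <> f ->
    isolated_exit v e -> isolated_exit v f ->
  (coatom e `|` coatom f)%O = reach_collapse.
Proof.
move=> ev fv nef ie jf; apply/le_anti/andP; split.
  by rewrite leUx !coatom_le_collapse.
have [|h|//] := @coatom_maximal e (coatom e `|` coatom f)%O ev ie (leUl _ _).
  by rewrite leUx !coatom_le_collapse.
have /cong_leP fe : (coatom f <= coatom e)%O by apply: le_trans h; exact: leUr.
have : avoiding f (erange e).
  by split; [exact: reaches_edge | exact: jf].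
move=> /coatom_zero_vertex/fe/coatom_vertex_zero [_].
by case; exact: reaches_refl.
Qed.

Lemma coatom_covered e : esource e = v -> isolated_exit v e ->
  covered_by (coatom e) reach_collapse.
Proof.
move=> ev ie; apply/covered_byP; split; last by move=> d; exact: coatom_maximal.
rewrite lt_leAnge coatom_le_collapse /=; apply/negP => /cong_leP h.
have /h/coatom_vertex_zero [_] : reach_collapse '1_v 0; last by apply; exact: reaches_edge.
apply/reach_collapseP; right; split; last exact: kills_zero.
by apply/kills_vertex; [exact: reaches_trans | exact: reaches_refl].
Qed.

Lemma fork_not_lower_semimodular : forked v -> ~ lower_semimodular (congruence G).
Proof.
move=> [e [f [ev fv nef ie jf]]] lsm.
have [||/covered_byP[_ cov] _] := lsm (coatom e) (coatom f).
- by rewrite coatom_join //; exact: coatom_covered.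
- by rewrite coatom_join //; exact: coatom_covered.
have := cov (rees_join (coatom e `&` coatom f)%O (@kills_ideal E (avoiding e))).
case; first exact: le_rees_join.
- apply: rees_join_le; first exact: leIl.
  move=> x y /coatom_of_kills ex /coatom_of_kills ey.
  by rewrite ex ey.
(* The new congruence kills [r(f)], which [coatom f] does not. *)
- move=> /cong_leP h.
  have ef : avoiding e (erange f).
    by split; [exact: reaches_edge | apply: ie => //; exact: nesym].
  have [] : (coatom e `&` coatom f)%O '1_(erange f) 0.
    apply: h; apply: rees_join_ideal; last exact: kills_zero.
    by apply/kills_vertex => //; exact: avoiding_hereditary.
  move=> _ /coatom_vertex_zero [_]; apply; exact: reaches_refl.
(* It does not relate [v] to [e e^-1], as this would make [coatom f] kill
   [r(f)]. *)
- move=> /cong_leP h.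
  case: (h _ _ (coatom_trace ev ie)) => [[_ fe]|[[k Kk [ek _]] _]].
    have := coatom_vertex_zero (exit_zero fe ev fv (nesym nef)).
    by case=> _; apply; exact: reaches_refl.
  have /coatom_vertex_zero[_] : coatom e '1_v 0.
    by apply: cong_trans ek _; exact: coatom_of_kills.
  by apply; exact: reaches_edge.
Qed.

End Fork.

Theorem theorem2p3 (E : graph) :
  (~ exists v : vertex E, forked v) <->
  lower_semimodular (congruence (graph_inverse_semigroup E)).
Proof.
split; first exact: lower_semimodular_of_no_forks.
by move=> lsm [v /fork_not_lower_semimodular].
Qed.
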